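(* Let $w$ be a group word which is not silly. Then $w$ has unbounded width in the class of all finite groups; that is, for every $m \in \mathbb{N}$ there exist a finite group $G$ and an element of the verbal subgroup $w(G)$ which is not a product of at most $m$ values of $w$ in $G$.
   Context: A group word $w = w(x_1,\dots,x_d)$ is an element of the free group $F$ on $x_1,\dots,x_d$. A value of $w$ in a group $G$ is an element $w(g_1,\dots,g_d)$ with $g_i \in G$; the verbal subgroup $w(G)$ is the subgroup generated by all values of $w$ in $G$. The word $w$ has width at most $m$ in $G$ if every element of $w(G)$ is a product of at most $m$ values of $w$. The word $w \in F$ is called silly if $w = 1$ in $F$ or $w(F) = F$. *)

(* Defs.v *)
From HB Require Import structures.
From mathcomp Require Import all_boot all_fingroup.

Set Implicit Arguments.
Unset Strict Implicit.
Unset Printing Implicit Defensive.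

Local Open Scope group_scope.

(* The letter (i, false) stands for x_i and (i, true) for x_i^-1. *)
Notation letter d := ('I_d * bool)%type.

Definition flip d (a : letter d) : letter d := (a.1, ~~ a.2).

Definition reduced d (s : seq (letter d)) : bool :=
  sorted (fun a b => b != flip a) s.
Arguments reduced : simpl never.

Definition push d (a : letter d) (s : seq (letter d)) : seq (letter d) :=
  if s is b :: s' then if b == flip a then s' else a :: s else [:: a].

Section FreeGroup.
Variable d : nat.
Implicit Types (a b : letter d) (s t u : seq (letter d)).

Lemma flipK : involutive (@flip d).
Proof. by case=> i e; rewrite /flip /= negbK. Qed.

Lemma reduced_cons a s :
  reduced (a :: s) = (if s is b :: _ then b != flip a else true) && reduced s.
Proof. by case: s. Qed.

Lemma push_reduced a s : reduced s -> reduced (push a s).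
Proof.
case: s => [|b s] //= red_bs; case: ifPn => [_ | ab].
  by move: red_bs; rewrite reduced_cons => /andP[].
by rewrite reduced_cons ab.
Qed.

Lemma pushK a s : reduced s -> push a (push (flip a) s) = s.
Proof.
case: s => [|b s] /= red_bs; first by rewrite eqxx.
rewrite flipK; case: eqP => [ba | _] /=; last by rewrite eqxx.
by move: red_bs; rewrite -ba; case: s => //= c s /andP[/negPf-> _].
Qed.

Lemma foldr_push_reduced s t : reduced t -> reduced (foldr (@push d) t s).
Proof. by move=> red_t; elim: s => //= a s; apply: push_reduced. Qed.

Lemma foldr_push_push a s t : reduced t ->
  foldr (@push d) t (push a s) = push a (foldr (@push d) t s).
Proof.
move=> red_t; case: s => [|b s] //=; case: eqP => //= ->.
by rewrite pushK ?foldr_push_reduced.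
Qed.

Lemma foldr_push_nil s : reduced s -> foldr (@push d) [::] s = s.
Proof.
elim: s => //= a s IHs; rewrite reduced_cons.
case/andP=> ab red_s; rewrite IHs //.
by case: s ab {IHs red_s} => //= b s /negPf->.
Qed.

Lemma inverse_reduced s : reduced s -> reduced (rev (map (@flip d) s)).
Proof.
rewrite /reduced rev_sorted sorted_map => red_s.
apply: sub_sorted red_s => a b /=.
by rewrite flipK; apply: contraNneq => ->.
Qed.

Lemma foldr_push_inverse s : reduced s ->
  foldr (@push d) s (rev (map (@flip d) s)) = [::].
Proof.
elim: s => //= a s IHs; rewrite reduced_cons.
case/andP=> _ red_s; rewrite rev_cons -cats1 foldr_cat /= flipK eqxx.
exact: IHs.
Qed.

(* The free group on x_0, ..., x_(d-1), as the set of reduced words; the product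
   is concatenation followed by free reduction. *)
Record free_group : Type :=
  FreeGroup { letters :> seq (letter d); _ : reduced letters }.
HB.instance Definition _ := [isSub for letters].
HB.instance Definition _ := [Countable of free_group by <:].

Lemma free_groupP (u : free_group) : reduced u. Proof. exact: valP. Qed.

Definition fg_one : free_group := @FreeGroup [::] isT.
Definition fg_mul (u v : free_group) : free_group :=
  FreeGroup (foldr_push_reduced u (free_groupP v)).
Definition fg_inv (u : free_group) : free_group :=
  FreeGroup (inverse_reduced (free_groupP u)).

Fact fg_mulA : associative fg_mul.
Proof.
move=> u v w; apply: val_inj => /=.
elim: (val u) => //= a s ->.
by rewrite foldr_push_push ?free_groupP.
Qed.

Fact fg_mul1 : left_id fg_one fg_mul.
Proof. by move=> u; apply: val_inj. Qed.

Fact fg_mulr1 : right_id fg_one fg_mul.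
Proof. by move=> u; apply: val_inj; rewrite /= foldr_push_nil ?free_groupP. Qed.

Fact fg_invK : involutive fg_inv.
Proof.
move=> u; apply: val_inj; rewrite /= map_rev revK -map_comp.
by rewrite (eq_map (g := id)) ?map_id //; apply: flipK.
Qed.

Fact fg_mulV : left_inverse fg_one fg_inv fg_mul.
Proof.
by move=> u; apply: val_inj; rewrite /= foldr_push_inverse ?free_groupP.
Qed.

Fact fg_mulrV : right_inverse fg_one fg_inv fg_mul.
Proof. by move=> u; rewrite -{1}[u]fg_invK fg_mulV. Qed.

HB.instance Definition _ := isGroup.Build free_group
  fg_mulA fg_mul1 fg_mulr1 fg_mulV fg_mulrV.

Definition fg_gen (i : 'I_d) : free_group := @FreeGroup [:: (i, false)] isT.

End FreeGroup.

Definition letter_eval d (G : groupType) (g : 'I_d -> G) (a : letter d) : G :=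
  if a.2 then (g a.1)^-1 else g a.1.

Definition word_eval d (G : groupType) (g : 'I_d -> G) (w : free_group d) : G :=
  \prod_(a <- letters w) letter_eval g a.

(* word_eval g is the unique homomorphism from the free group extending g. *)
Lemma word_eval_gen d (G : groupType) (g : 'I_d -> G) i :
  word_eval g (fg_gen i) = g i.
Proof. by rewrite /word_eval big_seq1. Qed.

Lemma word_evalM d (G : groupType) (g : 'I_d -> G) (u v : free_group d) :
  word_eval g (u * v) = word_eval g u * word_eval g v.
Proof.
rewrite /word_eval /=; elim: (letters u) => /= [|a s IHs].
  by rewrite big_nil mul1g.
rewrite big_cons -mulgA -IHs.
case: (foldr _ _ _) => [|b t] /=; first by rewrite big_seq1 big_nil mulg1.
case: eqP => [-> | _]; rewrite ?big_cons //.
by case: a => i [] /=; rewrite /letter_eval /= mulgA ?mulVg ?mulgV mul1g.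
Qed.

Lemma word_eval_uniq d (G : groupType) (f : free_group d -> G) :
  {morph f : u v / u * v} -> f =1 word_eval (fun i => f (fg_gen i)).
Proof.
move=> fM; have f1 : f 1 = 1 by apply: (mulgI (f 1)); rewrite -fM !mulg1.
have fV u : f u^-1 = (f u)^-1.
  by apply: (mulgI (f u)); rewrite -fM !mulgV f1.
case=> s red_s; rewrite /word_eval /=.
elim: s red_s => [|a s IHs] red_as.
  by rewrite big_nil -f1; congr f; apply: val_inj.
have /andP[as_ red_s] := eq_ind _ is_true red_as _ (reduced_cons a s).
rewrite big_cons -(IHs red_s).
have ->: letter_eval (fun i => f (fg_gen i)) a = f (@FreeGroup d [:: a] isT).
  case: a {IHs red_as as_} => i [] //=; rewrite /letter_eval /=.
  by rewrite -fV; congr f; apply: val_inj.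
rewrite -fM; congr f; apply: val_inj => /=.
by case: s as_ {IHs red_as red_s} => //= b s /negPf->.
Qed.

Definition is_value d (w : free_group d) (G : groupType) (x : G) : Prop :=
  exists g : 'I_d -> G, x = word_eval g w.

Inductive generated_by (G : groupType) (S : G -> Prop) : G -> Prop :=
| generated_in x : S x -> generated_by S x
| generated_1 : generated_by S 1
| generated_M x y : generated_by S x -> generated_by S y ->
    generated_by S (x * y)
| generated_V x : generated_by S x -> generated_by S x^-1.

Definition in_verbal d (w : free_group d) (G : groupType) (x : G) : Prop :=
  generated_by (is_value w (G := G)) x.

(* For m = 0, or s = [::], the product is 1. *)
Definition product_of_values d (w : free_group d) (G : groupType) (m : nat)
    (x : G) : Prop :=
  exists s : seq G,
    [/\ size s <= m, forall y, y \in s -> is_value w y & x = \prod_(y <- s) y].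

Definition silly d (w : free_group d) : Prop :=
  w = 1 \/ forall u : free_group d, in_verbal w u.

(* Main.v *)
Require Import Defs.
From mathcomp Require Import all_boot all_fingroup all_algebra.
From mathcomp Require Import zify.

(* If the exponent sums of [w] in its variables have no common prime divisor,
   every [u] in the free group is a product of powers of values of [w], namely
   of the values at [x_i := u], [x_j := 1]. So for [w] not silly some prime [p]
   divides all exponent sums. Expand [w] in the Magnus ring
   'F_p<<X_1, ..., X_d>>: this is 1 plus terms of degree at least [c], with a
   nonzero homogeneous part [f] of degree [c], and [c >= 2] by choice of [p].

   Take the block upper unitriangular matrices over 'F_p whose [c + 1] diagonal
   blocks have sizes n, 1, ..., 1, n' with [n' >= n]. Evaluating [w] at
   [1 + A_i] gives [1 + f(A)], where [f(A)] lives in the top right block and,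
   as it factors through the second block, has rank at most [d]. Multiplying
   such matrices adds the top right blocks, so a product of [m] values has a
   top right block of rank at most [d m]. But for each monomial of [f] the
   blocks can be chosen to single it out and yield any matrix unit, up to the
   scalar given by the coefficient; products of those reach rank [n > d m]. *)

Set Implicit Arguments.
Unset Strict Implicit.
Unset Printing Implicit Defensive.

Import GRing.Theory.

(** * Exponent sums of [w] and powers in the verbal subgroup *)

Section Verbal.
Local Open Scope group_scope.
Variables (d : nat) (w : free_group d).

Lemma in_verbal_expg (G : groupType) (x : G) k :
  in_verbal w x -> in_verbal w (x ^+ k).
Proof.
move=> wx; elim: k => [|k IHk]; first exact: generated_1.
by rewrite expgS; apply: generated_M.
Qed.

Lemma word_eval_single (G : groupType) (u : G) i :
  word_eval (fun j => if j == i then u else 1) w =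
  u ^+ count_mem (i, false) w * u ^- count_mem (i, true) w.
Proof.
rewrite /word_eval; elim: (letters w) => [|[j e] l IHl].
  by rewrite big_nil /= !expg0 invg1 mulg1.
rewrite big_cons IHl /= /letter_eval !xpair_eqE /=.
case: e; case: eqP => _ /=; rewrite ?invg1 ?mul1g ?mulgA ?add0n //.
  rewrite add1n expgSr invMg !mulgA; congr (_ * _).
  exact/commuteX/commute_sym/commuteV.
by rewrite -expgS.
Qed.

Lemma in_verbal_gcdn (G : groupType) (u : G) m n :
  in_verbal w (u ^+ m) -> in_verbal w (u ^+ n) -> in_verbal w (u ^+ gcdn m n).
Proof.
case: (posnP m) => [->|m0 wm wn]; first by rewrite gcd0n.
case: (egcdnP n m0) => a b def_gcd _.
have ->: u ^+ gcdn m n = (u ^+ n ^+ b)^-1 * u ^+ m ^+ a.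
  by rewrite -!expgM mulnC [(m * a)%N]mulnC def_gcd expgnDr mulKg.
by apply: generated_M; [apply: generated_V|]; apply: in_verbal_expg.
Qed.

Lemma not_silly_prime : ~ silly w -> exists2 p, prime p &
  forall i, count_mem (i, false) w = count_mem (i, true) w %[mod p].
Proof.
move=> nsilly.
(* [e i] is the absolute value of an exponent sum: one of the two truncated differences is 0. *)
pose e i := (count_mem (i, false) w - count_mem (i, true) w
             + (count_mem (i, true) w - count_mem (i, false) w))%N.
pose g := \big[gcdn/0%N]_i e i.
have g1 : g != 1%N.
  apply/eqP=> g1; apply: nsilly; right=> u; rewrite -[u]expg1 -g1.
  apply: (big_ind (fun n => in_verbal w (u ^+ n))) => [|m n|i _].
  - exact: generated_1.
  - exact: in_verbal_gcdn.
  have wi : in_verbal w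
      (u ^+ count_mem (i, false) w * u ^- count_mem (i, true) w).
    by rewrite -word_eval_single; apply: generated_in; eexists.
  have [le|/ltnW le] := leqP (count_mem (i, true) w) (count_mem (i, false) w);
    rewrite /e.
    by move: wi; rewrite -{1}(subnK le) expgnDr mulgK (eqnP le) addn0.
  move/generated_V: wi; rewrite invMg invgK -{1}(subnK le) expgnDr mulgK.
  by rewrite (eqnP le) add0n.
have [p p_pr pg] : exists2 p, prime p & p %| g.
  (* If all exponent sums vanish, then [g] is 0 and any prime will do. *)
  have [g0|g0] := posnP g; first by exists 2%N; rewrite ?g0.
  by exists (pdiv g); rewrite ?pdiv_dvd ?pdiv_prime // ltn_neqAle eq_sym g1.
exists p => // i; have : p %| e i.
  by apply: dvdn_trans pg _; rewrite /g (bigD1 i) //= dvdn_gcdl.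
have [le|/ltnW le] := leqP (count_mem (i, true) w) (count_mem (i, false) w);
  rewrite /e.
  by rewrite (eqnP le) addn0 -eqn_mod_dvd // => /eqP.
by rewrite (eqnP le) add0n -eqn_mod_dvd // => /eqP/esym.
Qed.

End Verbal.

Local Open Scope ring_scope.

(** * Nonvanishing of the Magnus expansion *)

Section Magnus.
Variables (d : nat) (F : fieldType).
Implicit Types (i : 'I_d) (s t : seq 'I_d) (f : seq 'I_d -> F).
Implicit Types (a : letter d) (l : seq (letter d)).

(** A noncommutative series is encoded by its coefficients on monomials. This is left multiplication
    by [1 + X_i], and [div_gen] is its inverse. *)
Definition mul_gen i f s : F :=
  f s + (if s is j :: s' then if j == i then f s' else 0 else 0).

Fixpoint div_gen i f s : F :=
  f s - (if s is j :: s' then if j == i then div_gen i f s' else 0 else 0).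

Definition mul_letter a f := if a.2 then div_gen a.1 f else mul_gen a.1 f.

Definition magnus l : seq 'I_d -> F :=
  foldr mul_letter (fun s => (s == [::])%:R) l.

Lemma div_genK i f : mul_gen i (div_gen i f) =1 f.
Proof. by case=> [|j s]; rewrite /mul_gen /= subrK. Qed.

Lemma eq_mul_gen i f g : f =1 g -> mul_gen i f =1 mul_gen i g.
Proof. by move=> fg [|j s]; rewrite /mul_gen !fg. Qed.

Lemma iter_div_genK i k f : iter k (mul_gen i) (iter k (div_gen i) f) =1 f.
Proof.
have eq_iter n g h : g =1 h -> iter n (mul_gen i) g =1 iter n (mul_gen i) h.
  by elim: n => //= n IHn gh; apply/eq_mul_gen/IHn.
elim: k => // k IHk s; rewrite iterSr -[RHS]IHk /=.
by apply: eq_iter; apply: div_genK.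
Qed.

Lemma mul_letter_nil a f : mul_letter a f [::] = f [::].
Proof.
by case: a => i [] /=; rewrite /mul_letter /mul_gen /= ?subr0 ?addr0.
Qed.

Lemma magnus_nil l : magnus l [::] = 1.
Proof. by elim: l => //= a l <-; rewrite mul_letter_nil. Qed.

Lemma magnus1 l i :
  magnus l [:: i] = (count_mem (i, false) l)%:R - (count_mem (i, true) l)%:R.
Proof.
elim: l => [|[j e] l IHl]; first by rewrite /= subr0.
have l0 := magnus_nil l; rewrite -[magnus (_ :: l)]/(mul_letter _ (magnus l)).
rewrite /= !xpair_eqE; case: e; rewrite /mul_letter /mul_gen /= ?l0 IHl ?subr0.
  rewrite eq_sym; case: eqP => _ /=; last by rewrite subr0 !add0n.
  by rewrite add0n natrD opprD addrAC -addrA; congr (_ + _); rewrite addrC.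
rewrite eq_sym; case: eqP => _ /=; last by rewrite addr0 !add0n.
by rewrite add0n natrD addrAC; congr (_ - _); rewrite addrC.
Qed.

(** Number of maximal runs of equal variables in a monomial. *)
Fixpoint blocks s : nat :=
  if s is j :: s' then (blocks s' + (ohead s' != Some j))%N else 0%N.

Lemma blocks_cons_ge i s : (blocks s <= blocks (i :: s))%N.
Proof. exact: leq_addr. Qed.

Lemma blocks_cons_le i s : (blocks (i :: s) <= (blocks s).+1)%N.
Proof. by rewrite /= -addn1 leq_add2l leq_b1. Qed.

(** Counting the blocks of [a.1 :: s] instead of [s] makes the condition stable under iteration:
    lengthening a leading run of [a.1] adds no block. *)
Lemma mul_letter_blocks a f n :
    (forall s, (n < blocks (a.1 :: s))%N -> f s = 0) ->
  forall s, (n < blocks (a.1 :: s))%N -> mul_letter a f s = 0.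
Proof.
case: a => i e /= f0 s; have f0' j s' : j = i ->
  (n < blocks (i :: j :: s'))%N -> (n < blocks (i :: s'))%N.
  by move=> -> /=; rewrite eqxx addn0.
case: e; rewrite /mul_letter /mul_gen /=.
  elim: s => [|j s IHs] lt_n; first by rewrite /= subr0 f0.
  rewrite /= f0 // sub0r; case: eqP => [ji|]; last by rewrite oppr0.
  by rewrite IHs ?oppr0 //; apply: f0' ji lt_n.
case: s => [|j s] lt_n; first by rewrite addr0 f0.
rewrite f0 // add0r; case: eqP => // ji.
by rewrite f0 //; apply: f0' ji lt_n.
Qed.

Section Power.
Variables (i : 'I_d) (t : seq 'I_d).
Hypothesis t_i : ohead t != Some i.

Lemma mul_gen_notin f : mul_gen i f t = f t.
Proof.
case: t t_i => [|j s] /=; rewrite /mul_gen ?addr0 //.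
by rewrite -[Some j == _]/(j == i) => /negPf->; rewrite addr0.
Qed.

(** Only the top term [X_i^k] of [(1 + X_i)^k] can reach [t]. Its coefficient is 1 in every
    characteristic, whereas that of [X_i] is [k], which may be 0 in [F]. *)
Lemma iter_mul_gen_top f K k q : (k + q <= K)%N ->
    (forall r, (0 < r <= K)%N -> f (nseq r i ++ t) = 0) ->
  iter k (mul_gen i) f (nseq (k + q) i ++ t) = if q == 0%N then f t else 0.
Proof.
move=> + f0; elim: k q => [|k IHk] q le_K /=.
  by case: q le_K => //= q le_K; rewrite -(f0 q.+1).
rewrite /mul_gen eqxx -/(mul_gen i) IHk ?(ltnW le_K) //.
rewrite -[i :: _]/(nseq (k + q).+1 i ++ t) -addnS IHk ?addnS //.
by rewrite add0r.
Qed.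

Lemma blocks_nseq q : (0 < q)%N -> blocks (nseq q i ++ t) = (blocks t).+1.
Proof.
case: q => // q _; elim: q => [|q IHq]; first by rewrite /= t_i addn1.
by rewrite [LHS]/= eqxx addn0 -IHq.
Qed.

(* For [e = true], if the new series vanished at all these points, multiplying it
   back by the [k]-th power of [1 + X_i] would give [f (nseq k i ++ t) = f t]. *)
Lemma iter_mul_letter_neq0 e k f :
    (0 < k)%N -> f t != 0 ->
    (forall r, (0 < r)%N -> f (nseq r i ++ t) = 0) ->
  exists2 q, (0 < q)%N & iter k (mul_letter (i, e)) f (nseq q i ++ t) != 0.
Proof.
move=> k0 ft0 f0; case: e; rewrite /mul_letter /=; last first.
  exists k => //; have := @iter_mul_gen_top f k k 0%N; rewrite addn0 => -> //.
  by move=> r /andP[/f0].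
set h := iter k _ f.
have [/hasP[q]|/hasPn h0] :=
  boolP (has (fun q => h (nseq q i ++ t) != 0) (iota 1 k)).
  by rewrite mem_iota => /andP[q0 _] hq; exists q.
have fE : iter k (mul_gen i) h =1 f by apply: iter_div_genK.
have ht : h t = f t.
  by rewrite -fE; elim: k {h0 fE k0} h => //= k IHk h; rewrite mul_gen_notin.
case/negP: ft0; rewrite -ht -(f0 k) // -fE.
have := @iter_mul_gen_top h k k 0%N; rewrite addn0 => -> // r r0.
by apply/eqP/negbNE/h0; rewrite mem_iota add1n ltnS.
Qed.

End Power.

Lemma iter_mul_letter_support a k f n t :
    (forall s, (n < blocks s)%N -> f s = 0) ->
    ohead t != Some a.1 -> blocks t = n -> f t != 0 -> (0 < k)%N ->
  (forall s, (n.+1 < blocks s)%N -> iter k (mul_letter a) f s = 0) /\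
  exists t', [/\ ohead t' = Some a.1, blocks t' = n.+1
               & iter k (mul_letter a) f t' != 0].
Proof.
move=> f0 ta tn ft0 k0; split=> [s lt_n|].
  have: (n.+1 < blocks (a.1 :: s))%N by apply: leq_trans (blocks_cons_ge _ _).
  elim: k s {lt_n k0} => [|k IHk] s lt_n.
    by apply: f0; rewrite -ltnS (leq_trans lt_n) ?blocks_cons_le.
  by apply: mul_letter_blocks lt_n.
have [r r0|q q0 fq] := iter_mul_letter_neq0 ta a.2 k0 ft0.
  by apply: f0; rewrite blocks_nseq ?tn.
exists (nseq q a.1 ++ t); rewrite blocks_nseq ?tn //; split=> //.
by case: q q0 {fq}.
Qed.

(* Splits the word after its first maximal power of a letter; every such power
   adds one block to the support of the Magnus series. *)
Lemma magnus_first_power a l : reduced (a :: l) ->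
  exists f n t k, [/\ forall s, (n < blocks s)%N -> f s = 0,
    ohead t != Some a.1, blocks t = n, f t != 0
    & (0 < k)%N /\ magnus (a :: l) = iter k (mul_letter a) f].
Proof.
elim: l a => [|b l IHl] a.
  exists (magnus [::]), 0%N, [::], 1%N; split=> //=; last by rewrite oner_eq0.
  by case.
rewrite reduced_cons => /andP[ba /IHl[f [n [t [k [f0 tb tn ft0 [k0 lE]]]]]]].
have [ab|ab] := eqVneq a b.
  exists f, n, t, k.+1; rewrite ab; split=> //; split=> //=.
  by rewrite -lE.
have ab1 : b.1 != a.1.
  move: ab ba; case: a b {IHl tb lE} => i e [j e'] /=.
  rewrite /flip !xpair_eqE /=.
  by rewrite eq_sym; case: eqVneq => //=; case: e e' => [] [].
have [g0 [t' [t'b t'n gt0]]] := iter_mul_letter_support f0 tb tn ft0 k0.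
exists (magnus (b :: l)), n.+1, t', 1%N; split=> //; rewrite ?lE ?t'b //.
Qed.

(** Injectivity of the Magnus map: a monomial with the most blocks that survives begins with the
    variable of the first letter, so it is not constant. *)
Lemma magnus_neq0 l : reduced l -> l != [::] ->
  exists2 s, s != [::] & magnus l s != 0.
Proof.
case: l => // a l /magnus_first_power[f [n [t [k [f0 ta tn ft0 [k0 ->]]]]]] _.
have [_ [t' [t'a _ gt0]]] := iter_mul_letter_support f0 ta tn ft0 k0.
by exists t' => //; apply: contra_eqN t'a => /eqP->.
Qed.

End Magnus.

(** * Evaluation of truncated series *)

Section Evaluation.
Variables (d : nat) (F : fieldType) (R : lalgType F) (A : 'I_d -> R).
Implicit Types (f : seq 'I_d -> F).

(* The value at [A] of the homogeneous component of degree [k] of the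
   noncommutative power series with coefficients [f]. *)
Fixpoint hom_eval k f : R :=
  if k is k'.+1 then \sum_i A i * hom_eval k' (fun s => f (i :: s))
  else (f [::])%:A.

Definition trunc_eval c f : R := \sum_(k < c.+1) hom_eval k f.

Lemma eq_hom_eval k f f' : (forall s, size s = k -> f s = f' s) ->
  hom_eval k f = hom_eval k f'.
Proof.
elim: k f f' => [|k IHk] f f' ff' /=; first by rewrite ff'.
by apply: eq_bigr => i _; congr (_ * _); apply: IHk => s sk; rewrite ff' //= sk.
Qed.

Lemma hom_eval0 k f : (forall s, size s = k -> f s = 0) -> hom_eval k f = 0.
Proof.
elim: k f => [|k IHk] f f0 /=; first by rewrite f0 // scale0r.
by rewrite big1 // => i _; rewrite IHk ?mulr0 // => s sk; rewrite f0 //= sk.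
Qed.

Lemma hom_evalD k f f' :
  hom_eval k (fun s => f s + f' s) = hom_eval k f + hom_eval k f'.
Proof.
elim: k f f' => [|k IHk] f f' /=; first by rewrite scalerDl.
by rewrite -big_split; apply: eq_bigr => i _; rewrite IHk mulrDr.
Qed.

Lemma hom_eval_mul_gen k i f :
  hom_eval k.+1 (mul_gen i f) = hom_eval k.+1 f + A i * hom_eval k f.
Proof.
rewrite [LHS]/= [X in X + _]/=.
rewrite (eq_bigr (fun j => A j * hom_eval k (fun s => f (j :: s))
  + A j * (if j == i then hom_eval k f else 0))).
  rewrite big_split /=; congr (_ + _).
  rewrite (bigD1 i) //= eqxx big1 ?addr0 //.
  by move=> j /negPf->; rewrite mulr0.
move=> j _; rewrite -mulrDr /mul_gen hom_evalD; congr (_ * (_ + _)).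
by case: eqP => // _; apply: hom_eval0.
Qed.

(** The hypothesis kills the one term of degree [c.+1] that truncation drops. *)
Lemma trunc_eval_mul_gen c i f : A i * hom_eval c f = 0 ->
  trunc_eval c (mul_gen i f) = (1 + A i) * trunc_eval c f.
Proof.
move=> Ac0; rewrite /trunc_eval mulrDl mul1r.
rewrite big_ord_recl [X in _ = X + _]big_ord_recl.
rewrite [X in _ = _ + _ * X]big_ord_recr /=.
rewrite mulrDr Ac0 addr0 mulr_sumr -addrA; congr (_ + _).
  by rewrite /mul_gen addr0.
rewrite -big_split; apply: eq_bigr => k _.
exact: hom_eval_mul_gen.
Qed.

Lemma trunc_eval_word c (G : groupType) (phi : G -> R) (g : 'I_d -> G)
    (w : free_group d) :
    phi 1%g = 1 -> {morph phi : x y / (x * y)%g >-> x * y} ->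
    (forall i, phi (g i) = 1 + A i) ->
    (forall i f, A i * hom_eval c f = 0) ->
  phi (word_eval g w) = trunc_eval c (magnus F w).
Proof.
move=> phi1 phiM phig A0; rewrite /word_eval.
elim: (letters w) => [|[i e] l IHl].
  rewrite big_nil phi1 /trunc_eval big_ord_recl big1 ?addr0 /= ?scale1r //.
  by move=> k _; rewrite big1 // => j _; rewrite hom_eval0 ?mulr0.
rewrite big_cons phiM IHl -[magnus _ (_ :: l)]/(mul_letter _ (magnus F l)).
case: e; rewrite /letter_eval /mul_letter /=; last first.
  by rewrite trunc_eval_mul_gen ?phig.
(* For an inverse letter, [1 + X_i] is factored out of the series, so that [phi (g i)] cancels
   against its inverse. *)
have -> : trunc_eval c (magnus F l) =
    phi (g i) * trunc_eval c (div_gen i (magnus F l)).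
  rewrite phig -trunc_eval_mul_gen // /trunc_eval; apply: eq_bigr => k _.
  by apply: eq_hom_eval => s _; rewrite div_genK.
by rewrite mulrA -phiM mulVg phi1 mul1r.
Qed.

End Evaluation.

Lemma eq_hom_eval_point d (F : fieldType) (R : lalgType F)
    (A A' : 'I_d -> R) k f :
  A =1 A' -> hom_eval A k f = hom_eval A' k f.
Proof.
move=> eqA; elim: k f => //= k IHk f.
by apply: eq_bigr => i _; rewrite eqA IHk.
Qed.

(** * Matrices filtered by a grading of the indices *)

Section Raising.
Variables (F : fieldType) (N : nat) (deg : 'I_N.+1 -> nat).
Implicit Types (A B : 'M[F]_N.+1).

(** Support on or above the [k]-th block superdiagonal; grading the indices avoids explicit block
    decompositions. *)
Definition raises k B : bool :=
  [forall i, forall j, (deg j < deg i + k)%N ==> (B i j == 0)].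

Lemma raisesP k B :
  reflect (forall i j, (deg j < deg i + k)%N -> B i j = 0) (raises k B).
Proof.
apply: (iffP forallP) => [rB i j lt_ij | B0 i].
  by have /forallP/(_ j)/implyP/(_ lt_ij)/eqP := rB i.
by apply/forallP=> j; apply/implyP=> /B0->.
Qed.

Lemma raises_le k l B : (k <= l)%N -> raises l B -> raises k B.
Proof.
move=> le_kl /raisesP rB; apply/raisesP=> i j lt_ij; apply: rB.
by apply: leq_trans lt_ij _; rewrite leq_add2l.
Qed.

Lemma raises0 k : raises k 0.
Proof. by apply/raisesP=> i j _; rewrite mxE. Qed.

Lemma raises1 : raises 0 1.
Proof.
apply/raisesP=> i j; rewrite addn0 mxE; case: eqP => // ->.
by rewrite ltnn.
Qed.

Lemma raisesD k A B : raises k A -> raises k B -> raises k (A + B).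
Proof.
move=> /raisesP rA /raisesP rB; apply/raisesP=> i j lt_ij.
by rewrite mxE rA ?rB ?addr0.
Qed.

Lemma raisesZ k a A : raises k A -> raises k (a *: A).
Proof.
by move=> /raisesP rA; apply/raisesP=> i j /rA Aij0; rewrite mxE Aij0 mulr0.
Qed.

Lemma raisesM k l A B : raises k A -> raises l B -> raises (k + l) (A * B).
Proof.
move=> /raisesP rA /raisesP rB; apply/raisesP=> i j lt_ij.
rewrite mxE big1 // => z _; have [lt_iz|le_iz] := ltnP (deg z) (deg i + k).
  by rewrite rA ?mul0r.
rewrite rB ?mulr0 // (leq_trans lt_ij) // addnA leq_add2r //.
Qed.

Lemma raises_hom_eval d (A : 'I_d -> 'M[F]_N.+1) k f :
  (forall i, raises 1 (A i)) -> raises k (hom_eval A k f).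
Proof.
move=> rA; elim: k f => [|k IHk] f /=; first exact/raisesZ/raises1.
apply: (big_ind (raises k.+1)) => [|B C|i _].
- exact: raises0.
- exact: raisesD.
exact: (raisesM (rA i) (IHk _)).
Qed.

Variable c : nat.
Hypothesis deg_le : forall i, (deg i <= c)%N.

Lemma raises_eq0 k B : (c < k)%N -> raises k B -> B = 0.
Proof.
move=> lt_ck /raisesP rB; apply/matrixP=> i j; rewrite rB ?mxE //.
by rewrite (leq_ltn_trans (deg_le j)) // (leq_trans lt_ck) ?leq_addl.
Qed.

(** [A] is nilpotent, so the finite geometric series in [- A] inverts [1 + A]. *)
Lemma raises1_unit A : raises 1 A -> 1 + A \is a GRing.unit.
Proof.
move=> rA; have rAX k : raises k ((- A) ^+ k).
  elim: k => [|k IHk]; first exact: raises1.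
  by rewrite exprS; apply: (@raisesM 1) => //; rewrite -scaleN1r raisesZ.
have := subrX1 (- A) c.+1; rewrite (raises_eq0 (ltnSn c) (rAX _)) sub0r.
by rewrite -opprD addrC mulNr => /oppr_inj/esym/mulmx1_unit[].
Qed.

End Raising.

(** * The finite group of block unitriangular matrices *)

Section GradedGroup.
Variables (F : finFieldType) (N : nat) (deg : 'I_N.+1 -> nat).

Definition graded_unitri : {set {unit 'M[F]_N.+1}} :=
  [set u | raises deg 1 (val u - 1)].

Lemma group_set_graded_unitri : group_set graded_unitri.
Proof.
apply/group_setP; split=> [|u v]; first by rewrite inE subrr raises0.
rewrite !inE => ru rv; have -> : val (u * v)%g - 1 =
    (val u - 1) * (val v - 1) + ((val u - 1) + (val v - 1)).
  rewrite FinRing.val_unitM -{1}[val u](subrK 1) -{1}[val v](subrK 1).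
  by rewrite mulrDl mul1r mulrDr mulr1 addrA addrK -addrA.
apply: raisesD; last exact: raisesD.
exact: (raises_le (leqnSn 1) (raisesM ru rv)).
Qed.

Canonical graded_unitri_group := Group group_set_graded_unitri.

Definition gmx (x : subg_of graded_unitri_group) : 'M[F]_N.+1 :=
  FinRing.uval (sgval x).

Lemma gmxM : {morph gmx : x y / (x * y)%g >-> x * y}. Proof. by []. Qed.

Lemma raises_gmx x : raises deg 1 (gmx x - 1).
Proof. by have := subgP x; rewrite inE. Qed.

Variable c : nat.
Hypothesis deg_le : forall i, (deg i <= c)%N.

Lemma gmx_surj A : raises deg 1 A -> exists x, gmx x = 1 + A.
Proof.
move=> rA.
pose u : {unit 'M[F]_N.+1} := FinRing.unit _ (raises1_unit deg_le rA).
have Hu : u \in graded_unitri_group by rewrite inE /= addrC addKr.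
by exists (subg graded_unitri_group u); rewrite /gmx subgK.
Qed.

Hypothesis c_gt0 : (0 < c)%N.

(** Cross terms raise degrees by [c + c], which exceeds [c], so they vanish. *)
Lemma gmx_prod (I : Type) (r : seq I) (x : I -> subg_of graded_unitri_group)
    (V : I -> 'M[F]_N.+1) :
    (forall i, gmx (x i) = 1 + V i) -> (forall i, raises deg c (V i)) ->
  gmx (\prod_(i <- r) x i)%g = 1 + \sum_(i <- r) V i.
Proof.
move=> xV rV; elim: r => [|i r IHr]; first by rewrite !big_nil addr0.
rewrite !big_cons gmxM IHr xV mulrDl mul1r mulrDr mulr1.
have rS : raises deg c (\sum_(j <- r) V j).
  apply: (big_ind (raises deg c)) => [|A B|//].
    exact: raises0.
  exact: raisesD.
rewrite (raises_eq0 deg_le _ (raisesM (rV i) rS)) ?addr0 -?addrA.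
  by congr (_ + _); rewrite addrC.
by rewrite -addn1 leq_add2l.
Qed.

End GradedGroup.

(** * Rank bounds *)

Section Rank.
Variable F : fieldType.

Lemma mxrank_sum_leq (I : Type) (r : seq I) m n k (V : I -> 'M[F]_(m, n)) :
    (forall i, (\rank (V i) <= k)%N) ->
  (\rank (\sum_(i <- r) V i)%R <= k * size r)%N.
Proof.
move=> rV; elim: r => [|i r IHr]; first by rewrite big_nil mxrank0.
rewrite big_cons mulnS (leq_trans (mxrank_add _ _)) ?leq_add //.
Qed.

Lemma mxrank_mxsub m n m' n' (a : 'I_m' -> 'I_m) (b : 'I_n' -> 'I_n)
  (M : 'M[F]_(m, n)) : (\rank (mxsub a b M) <= \rank M)%N.
Proof.
rewrite -[M in mxsub _ _ M]mulmx1 mxsub_mul rowsubE.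
by rewrite (leq_trans (mxrankM_maxl _ _)) ?mxrankM_maxr.
Qed.

Lemma mxrank_sum_delta n m (a b : 'I_n -> 'I_m) :
  injective a -> injective b ->
  \rank (\sum_i (delta_mx (a i) (b i) : 'M[F]_m))%R = n.
Proof.
move=> a_inj b_inj; apply/eqP; rewrite eqn_leq; apply/andP; split.
  have := @mxrank_sum_leq _ (index_enum 'I_n) m m 1
            (fun i => delta_mx (a i) (b i)).
  rewrite mul1n -[index_enum _]enumT size_enum_ord; apply=> i.
  by rewrite mxrank_delta.
rewrite -[X in (X <= _)%N](mxrank1 F).
(* Rows [a] and columns [b] cut out an identity matrix of size [n]. *)
rewrite -(_ : mxsub a b (\sum_i delta_mx (a i) (b i)) = 1%:M).
  exact: mxrank_mxsub.
apply/matrixP=> i j.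
rewrite !mxE summxE (bigD1 i) //= big1 => [|k ki]; rewrite mxE.
  by rewrite eqxx (inj_eq b_inj) addr0 eq_sym.
by rewrite (inj_eq a_inj) eq_sym (negPf ki).
Qed.

Variables (N : nat) (deg : 'I_N.+1 -> nat) (c : nat) (z : 'I_N.+1).
Hypothesis deg_le : forall i, (deg i <= c)%N.
Hypothesis deg1 : forall i, deg i = 1%N -> i = z.

(* A product [A i * B] of degree [c] passes through degree 1, hence through the
   index [z], and so it is a column times a row. *)
Lemma rank_hom_eval d (A : 'I_d -> 'M[F]_N.+1) f :
    (1 < c)%N -> (forall i, raises deg 1 (A i)) ->
  (\rank (hom_eval A c f) <= d)%N.
Proof.
case: c deg_le => // c' deg_le' c_gt1 rA /=.
rewrite -[X in (_ <= X)%N]mul1n -[X in (_ <= _ * X)%N]size_enum_ord enumT.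
apply: mxrank_sum_leq => i.
set B := hom_eval _ _ _; have rB : raises deg c' B by apply: raises_hom_eval.
suff ->: A i * B = col z (A i) *m row z B by apply: mulmx_max_rank.
apply/matrixP=> x y.
rewrite !mxE big_ord1 !mxE (bigD1 z) //= big1 ?addr0 // => k kz.
have [lt_xk|le_xk] := ltnP (deg k) (deg x + 1)%N.
  by rewrite ((raisesP _ _ _ (rA i)) _ _ lt_xk) mul0r.
rewrite ((raisesP _ _ _ rB)) ?mulr0 //.
rewrite (leq_ltn_trans (deg_le' y)) // -[c'.+1]add1n ltn_add2r.
rewrite ltn_neqAle (leq_trans _ le_xk) ?leq_addl // andbT eq_sym.
by apply: contraNneq kz => /deg1->.
Qed.

End Rank.

(** * Values of [w] in the matrix group *)

Section Value.
Variables (d : nat) (w : free_group d) (F : finFieldType) (c : nat).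
Variables (N : nat) (deg : 'I_N.+1 -> nat).
Hypothesis deg_le : forall i, (deg i <= c)%N.
Hypothesis c_gt0 : (0 < c)%N.
Hypothesis low0 : forall s, (0 < size s < c)%N -> magnus F w s = 0.

Let G : finGroupType := subg_of (graded_unitri_group F deg).

(** Degrees strictly between 0 and [c] vanish by [low0], those above [c] because no matrix raises
    degrees that far. *)
Lemma gmx_word_eval (g : 'I_d -> G) :
  gmx (word_eval g w) = 1 + hom_eval (fun i => gmx (g i) - 1) c (magnus F w).
Proof.
rewrite (@trunc_eval_word _ _ _ (fun i => gmx (g i) - 1) c _ (@gmx F N deg)) //.
- rewrite /trunc_eval; case: c c_gt0 low0 => // c' _ low.
  rewrite big_ord_recl big_ord_recr /= magnus_nil scale1r big1 ?add0r // => k _.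
  apply: (@hom_eval0 _ _ _ _ k.+1) => s sk.
  by rewrite low // sk /= ltnS ltn_ord.
- by move=> i; rewrite addrC subrK.
move=> i f; apply: (raises_eq0 deg_le (ltnSn c)).
have rg j : raises deg 1 (gmx (g j) - 1) by apply: raises_gmx.
exact: (raisesM (rg i) (raises_hom_eval _ _ rg)).
Qed.

End Value.

(** * Matrices that single out one monomial *)

Section Path.
Variables (d : nat) (F : fieldType) (N : nat) (deg : 'I_N.+1 -> nat).
Variables (s : seq 'I_d) (p : nat -> 'I_N.+1).
Hypothesis deg_le : forall i, (deg i <= size s)%N.
Hypothesis deg_p : forall k, (k <= size s)%N -> deg (p k) = k.

(** Adjacency matrix of the edges labelled [i] on the path [p], whose successive edges are labelled
    by [s]; the full path spells only [s]. *)
Definition path_mx (i : 'I_d) : 'M[F]_N.+1 :=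
  \matrix_(x, y) [&& onth s (deg x) == Some i, x == p (deg x)
                   & y == p (deg x).+1]%:R.

Lemma raises_path_mx i : raises deg 1 (path_mx i).
Proof.
apply/raisesP=> x y lt_y; rewrite mxE; case: and3P => // -[sx _ /eqP y_p].
have lt_x : (deg x < size s)%N by rewrite -onthTE (eqP sx).
by rewrite y_p deg_p // addn1 ltnn in lt_y.
Qed.

Lemma hom_eval_path_from k r f y : (k + r <= size s)%N ->
  hom_eval path_mx r f (p k) y = f (take r (drop k s)) * (y == p (k + r))%:R.
Proof.
elim: r k f => [|r IHr] k f le_s /=.
  by rewrite addn0 take0 !mxE eq_sym.
have lt_k : (k < size s)%N.
  by apply: leq_trans le_s; rewrite addnS ltnS leq_addr.
have [i si] : exists i, onth s k = Some i.
  by move: lt_k; rewrite -onthTE; case: onth => // i; exists i.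
have ->: take r.+1 (drop k s) = i :: take r (drop k.+1 s).
  by rewrite (drop_nth i lt_k) /=; congr (_ :: _); exact: onth_nth si.
rewrite summxE (bigD1 i) //= big1 ?addr0 => [|j ji].
  rewrite mxE (bigD1 (p k.+1)) //= big1 ?addr0 => [|x xp].
    by rewrite mxE deg_p ?(ltnW lt_k) // si !eqxx mul1r IHr addSnnS.
  by rewrite mxE deg_p ?(ltnW lt_k) // (negPf xp) !andbF mul0r.
rewrite mxE big1 // => x _; rewrite mxE deg_p ?(ltnW lt_k) // si.
by rewrite -[Some i == _]/(i == j) eq_sym (negPf ji) mul0r.
Qed.

Lemma hom_eval_path f : (0 < size s)%N ->
  hom_eval path_mx (size s) f = f s *: delta_mx (p 0%N) (p (size s)).
Proof.
move=> s_gt0; apply/matrixP=> x y; rewrite !mxE.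
have [->|xp] := eqVneq x (p 0%N).
  by rewrite hom_eval_path_from // drop0 take_size.
rewrite mulr0; have [x0|x_gt0] := posnP (deg x); last first.
  have /raisesP-> // := raises_hom_eval (size s) f raises_path_mx.
  by rewrite (leq_ltn_trans (deg_le y)) // -[X in (X < _)%N]add0n ltn_add2r.
case: (size s) s_gt0 => //= r _; rewrite summxE big1 // => i _.
rewrite mxE big1 // => z _; rewrite mxE x0 (negPf xp) !andbF mul0r //.
Qed.

End Path.

(** * The lowest nonconstant monomials of the expansion *)

Section Leading.
Variables (d : nat) (w : free_group d).

Lemma magnus_leading_monomial (F : fieldType) : w != 1%g ->
  exists s, [/\ (0 < size s)%N, magnus F w s != 0
    & forall t, (0 < size t < size s)%N -> magnus F w t = 0].
Proof.
move=> w1.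
pose P k := (0 < k)%N && [exists t : k.-tuple 'I_d, magnus F w t != 0].
have exP : exists k, P k.
  have [s s0 ws] := magnus_neq0 F (free_groupP w) w1.
  exists (size s); rewrite /P lt0n size_eq0 s0.
  by apply/existsP; exists (in_tuple s).
case: (ex_minnP exP) => k /andP[k0 /existsP[s ws]] min_k.
exists s; rewrite size_tuple; split=> // t /andP[t0 lt_t].
apply/eqP; apply: contraTT lt_t => wt; rewrite -leqNgt; apply: min_k.
by rewrite /P t0; apply/existsP; exists (in_tuple t).
Qed.

Lemma magnus_size1 p s : prime p ->
    (forall i, count_mem (i, false) w = count_mem (i, true) w %[mod p]) ->
  size s = 1%N -> magnus 'F_p w s = 0.
Proof.
case: s => [|i []] // p_pr eq_w _; rewrite magnus1.
by rewrite -(Fp_nat_mod p_pr) eq_w Fp_nat_mod // subrr.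
Qed.

End Leading.

(** * A concrete grading with [n] paths *)

Section Layers.
Variables (n c : nat).

(* Degree 0 occurs [n] times, the degrees strictly between 0 and [c] once each,
   and degree [c] more than [n] times. *)
Definition layer (j : 'I_(n + c + n).+1) : nat := minn (j.+1 - n) c.

(** The paths have distinct ends in degrees 0 and [c] and share the single index of each degree in
    between. *)
Definition layer_path (i : 'I_n) (k : nat) : 'I_(n + c + n).+1 :=
  inord (if k == 0%N then i : nat
         else if k == c then n + c + i else n + k.-1)%N.

Lemma layer_le j : (layer j <= c)%N. Proof. exact: geq_minr. Qed.

Lemma layer1 j : (1 < c)%N -> layer j = 1%N -> j = inord n.
Proof.
by move=> c1 j1; apply: ord_inj; rewrite inordK; move: j1; rewrite /layer; lia.
Qed.

Lemma layer_pathE i k : (k <= c)%N ->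
  layer_path i k = (if k == 0%N then i : nat
    else if k == c then n + c + i else n + k.-1)%N :> nat.
Proof.
by move=> le_k; rewrite inordK //; have := ltn_ord i;
  case: (k =P 0%N); case: (k =P c); lia.
Qed.

Lemma layer_layer_path i k : (k <= c)%N -> layer (layer_path i k) = k.
Proof. 
by move=> le_k; rewrite /layer layer_pathE //; have := ltn_ord i;
  case: (k =P 0%N); case: (k =P c); lia.
Qed.

Lemma layer_path_inj k : (k == 0%N) || (k == c) -> injective (layer_path^~ k).
Proof.
move=> k0c i j /(congr1 val) /=; rewrite !layer_pathE; try lia.
move=> ij; apply: ord_inj; move: ij k0c; case: (k =P 0%N); case: (k =P c); lia.
Qed.

End Layers.

(** * Comparison of ranks *)

Theorem theorem1 (d : nat) (w : free_group d) (hw : ~ silly w) (m : nat) :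
  exists (G : finGroupType) (x : G),
    in_verbal w x /\ ~ product_of_values w m x.
Proof.
have [p p_pr w_p] := not_silly_prime hw.
have w1 : w != 1%g by apply/eqP=> w1; apply: hw; left.
have [s [s_gt0 ws low0]] := magnus_leading_monomial 'F_p w1.
have s_gt1 : (1 < size s)%N.
  rewrite ltn_neqAle s_gt0 andbT eq_sym; apply: contraNneq ws => s1.
  by rewrite magnus_size1.
pose n := (d * m).+1; pose c := size s; pose deg := @layer n c.
have deg_le : forall i, (deg i <= c)%N by apply: layer_le.
pose G : finGroupType := subg_of (graded_unitri_group 'F_p deg).
have valueE := gmx_word_eval deg_le s_gt0 low0.
pose V (g : 'I_d -> G) := hom_eval (fun i => gmx (g i) - 1) c (magnus 'F_p w).
have rV g : raises deg c (V g).
  by apply: raises_hom_eval => i; apply: raises_gmx.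
have rank_V g : (\rank (V g) <= d)%N.
  apply: (rank_hom_eval deg_le (z := inord n)) => //.
    by move=> i; apply: layer1.
  by move=> i; apply: raises_gmx.
have path_g i : exists g : 'I_d -> G,
    V g = magnus 'F_p w s *: delta_mx (layer_path c i 0) (layer_path c i c).
  have deg_p k : (k <= c)%N -> deg (layer_path c i k) = k.
    exact: layer_layer_path.
  have /fin_all_exists[g gE] l :
      exists y : G, gmx y = 1 + path_mx 'F_p deg s (layer_path c i) l.
    by apply: (gmx_surj deg_le); apply: raises_path_mx.
  exists g; rewrite -(hom_eval_path deg_le deg_p _ s_gt0).
  by apply: eq_hom_eval_point => l; rewrite gE addrC addKr.
have [g gE] := fin_all_exists path_g.
pose x : G := (\prod_i word_eval (g i) w)%g.
exists G, x; split.
  rewrite /x; apply: (big_ind (in_verbal w (G := G))).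
  - exact: generated_1.
  - exact: generated_M.
  by move=> i _; apply: generated_in; exists (g i).
case=> r [size_r r_w x_r].
(* The factors are replaced by tuples giving them, so that [gmx_prod] applies. *)
have [h hE] : exists h : seq ('I_d -> G),
    size h = size r /\ x = (\prod_(k <- h) word_eval k w)%g.
  rewrite x_r; elim: r r_w {size_r x_r} => [|y r IHr] r_w.
    by exists [::]; rewrite !big_nil.
  have [k ->] := r_w y (mem_head _ _).
  have [z zr|h [sz rE]] := IHr; first by apply: r_w; rewrite inE zr orbT.
  by exists (k :: h); rewrite !big_cons /= sz rE.
case: hE => size_h xE.
(* The top right block of [x] is computed from both products: [n] matrix units with disjoint rows
   and columns, scaled by a nonzero coefficient, against at most [m] blocks of rank at most [d]. *)
have := gmx_prod deg_le s_gt0 h valueE rV; rewrite -xE.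
rewrite (gmx_prod deg_le s_gt0 _ (fun i => valueE (g i)) (fun i => rV (g i))).
move/addrI/(congr1 mxrank).
rewrite (eq_bigr _ (fun i _ => gE i)) -scaler_sumr mxrank_scale_nz //.
rewrite mxrank_sum_delta; first last.
- by apply: layer_path_inj; rewrite eqxx orbT.
- exact: layer_path_inj.
move=> n_rank; have := mxrank_sum_leq h rank_V.
by rewrite -n_rank size_h ltnNge leq_mul2l size_r orbT.
Qed.
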